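(* Let $L$ be a multiplicative lattice with infinite $m$-distributivity, let $h\in L$, and let $n\in[0,h]_L$. If $0$ is a prime element of $[0,n]_L$, then $\mathrm{l.ann}_{[0,h]}(n)$ coincides with $\mathrm{r.ann}_{[0,h]}(n)$ and is the unique element $p\in\mathrm{Spec}([0,h]_L)$ such that $p\wedge n=0$.
   Context: A multiplicative lattice is a complete lattice $(L,\vee,\wedge)$ with least element $0$ and greatest element $1$, equipped with a further binary operation $\cdot\colon L\times L\to L$ satisfying $x\cdot y\leq x\wedge y$ for all $x,y\in L$. No further axioms (associativity, commutativity, identity) are required. Write $xy=x\cdot y$. $L$ has infinite $m$-distributivity if $\left(\bigvee X\right)\left(\bigvee Y\right)=\bigvee_{(x,y)\in X\times Y}xy$ for any two subsets $X,Y\subseteq L$. For $h\in L$, $[0,h]_L=\{\,x\in L\mid x\leq h\,\}$, which is a multiplicative lattice with the operations inherited from $L$ and with greatest element $h$. In a multiplicative lattice $M$ with greatest element $1_M$, an element $p$ is prime if $p\neq 1_M$ and, for all $x,y\in M$, $xy\leq p$ implies $x\leq p$ or $y\leq p$; $\mathrm{Spec}(M)$ is the set of prime elements of $M$. Thus $p\in[0,h]_L$ is prime in $[0,h]_L$ if $p\neq h$ and, for all $x,y\in L$ with $x\leq h$ and $y\leq h$, $xy\leq p$ implies $x\leq p$ or $y\leq p$. For $n\in[0,h]_L$, the right annihilator is $\mathrm{r.ann}_{[0,h]}(n)=\bigvee\{\,y\in[0,h]_L\mid ny=0\,\}$ and the left annihilator is $\mathrm{l.ann}_{[0,h]}(n)=\bigvee\{\,y\in[0,h]_L\mid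 yn=0\,\}$. *)

(* Defs.v *)
From HB Require Import structures.
From mathcomp Require Import all_boot all_order.
From mathcomp Require Import boolp classical_sets.

Set Implicit Arguments.
Unset Strict Implicit.
Unset Printing Implicit Defensive.

Import Order.TTheory.
Local Open Scope order_scope.

(* [set L] is the type of arbitrary (classical) subsets of L; arbitrary meets
   follow from arbitrary joins. *)
HB.mixin Record TBLattice_isComplete (d : Order.disp_t) L
    of Order.TBLattice d L := {
  bigjoin : set L -> L;
  bigjoin_supremum : forall A : set L, supremums A (bigjoin A)
}.

#[short(type="completeLatticeType")]
HB.structure Definition CompleteLattice (d : Order.disp_t) :=
  { L of Order.TBLattice d L & TBLattice_isComplete d L }.

HB.mixin Record CompleteLattice_hasMul (d : Order.disp_t) L
    of CompleteLattice d L := {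
  lmul : L -> L -> L;
  lmul_le_meet : forall x y : L, lmul x y <= x `&` y
}.

#[short(type="multLatticeType")]
HB.structure Definition MultLattice (d : Order.disp_t) :=
  { L of CompleteLattice d L & CompleteLattice_hasMul d L }.

Reserved Notation "x ** y" (at level 40, left associativity).
Notation "x ** y" := (lmul x y) : order_scope.

Definition infinitely_m_distributive (d : Order.disp_t)
    (L : multLatticeType d) : Prop :=
  forall X Y : set L,
    bigjoin X ** bigjoin Y =
    bigjoin [set x ** y | x in X & y in Y]%classic.

Definition prime_elt (d : Order.disp_t) (M : multLatticeType d) (p : M) : Prop :=
  p <> \top /\ forall x y : M, x ** y <= p -> x <= p \/ y <= p.

Definition Spec (d : Order.disp_t) (M : multLatticeType d) : set M :=
  [set p | prime_elt p]%classic.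
Arguments Spec {d} M.

Definition r_ann (d : Order.disp_t) (M : multLatticeType d) (n : M) : M :=
  bigjoin [set y | n ** y = \bot]%classic.

Definition l_ann (d : Order.disp_t) (M : multLatticeType d) (n : M) : M :=
  bigjoin [set y | y ** n = \bot]%classic.

(* The multiplicative lattice [0, h]_L. *)
Record lower_interval (d : Order.disp_t) (L : multLatticeType d) (h : L) :=
  LowerInterval { li_val :> L; li_valP : li_val <= h }.

Section LowerInterval.
Variables (d : Order.disp_t) (L : multLatticeType d) (h : L).
Local Notation I := (lower_interval h).

HB.instance Definition _ := [isSub for @li_val d L h].
HB.instance Definition _ := [Choice of I by <:].

Definition li_le (x y : I) : bool := val x <= val y.

Fact li_le_refl : reflexive li_le. Proof. by move=> x; exact: lexx. Qed.
Fact li_le_anti : antisymmetric li_le.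
Proof. by move=> x y /le_anti /val_inj. Qed.
Fact li_le_trans : transitive li_le. Proof. by move=> y x z; exact: le_trans. Qed.

HB.instance Definition _ := Order.Le_isPOrder.Build d I
  li_le_refl li_le_anti li_le_trans.

Lemma li_leE (x y : I) : (x <= y) = (val x <= val y). Proof. by []. Qed.

Fact li_meet_proof (x y : I) : val x `&` val y <= h.
Proof. by rewrite leIxl // (valP x). Qed.
Fact li_join_proof (x y : I) : val x `|` val y <= h.
Proof. by rewrite leUx (valP x) (valP y). Qed.

Definition li_meet (x y : I) : I := LowerInterval (li_meet_proof x y).
Definition li_join (x y : I) : I := LowerInterval (li_join_proof x y).

Fact li_lexI (x y z : I) : (x <= li_meet y z) = (x <= y) && (x <= z).
Proof. by rewrite !li_leE lexI. Qed.
Fact li_leUx (x y z : I) : (li_join x y <= z) = (x <= z) && (y <= z).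
Proof. by rewrite !li_leE leUx. Qed.

HB.instance Definition _ := Order.POrder_isMeetSemilattice.Build d I li_lexI.
HB.instance Definition _ := Order.POrder_isJoinSemilattice.Build d I li_leUx.

Definition li_bot : I := LowerInterval (le0x h).
Definition li_top : I := LowerInterval (lexx h).

Fact li_le0x (x : I) : li_bot <= x. Proof. by rewrite li_leE le0x. Qed.
Fact li_lex1 (x : I) : x <= li_top. Proof. exact: (valP x). Qed.

HB.instance Definition _ := Order.hasBottom.Build d I li_le0x.
HB.instance Definition _ := Order.hasTop.Build d I li_lex1.

Fact li_bigjoin_proof (A : set I) : bigjoin [set val x | x in A]%classic <= h.
Proof.
have [_] := bigjoin_supremum [set val x | x in A]%classic; apply.
by move=> _ [x _ <-]; exact: (valP x).
Qed.

Definition li_bigjoin (A : set I) : I :=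
  LowerInterval (li_bigjoin_proof A).

Fact li_bigjoin_supremum (A : set I) : supremums A (li_bigjoin A).
Proof.
have [ub lub] := bigjoin_supremum [set val x | x in A]%classic.
split=> [x Ax|y yub]; rewrite li_leE; first by apply: ub; exists x.
by apply: lub => _ [x Ax <-]; exact: yub.
Qed.

HB.instance Definition _ := TBLattice_isComplete.Build d I li_bigjoin_supremum.

Fact li_mul_proof (x y : I) : val x ** val y <= h.
Proof. exact: le_trans (lmul_le_meet _ _) (li_meet_proof x y). Qed.

Definition li_mul (x y : I) : I := LowerInterval (li_mul_proof x y).

Fact li_mul_le_meet (x y : I) : li_mul x y <= x `&` y.
Proof. exact: lmul_le_meet. Qed.

HB.instance Definition _ := CompleteLattice_hasMul.Build d I li_mul_le_meet.

End LowerInterval.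

(* Main.v *)
Require Import Defs.
From HB Require Import structures.
From mathcomp Require Import all_boot all_order.
From mathcomp Require Import boolp classical_sets.

Import Order.TTheory.
Local Open Scope order_scope.

(** Primality of [0] in [[0, n]] says that [n <> 0] and that the interval has
    no zero divisors.  Distributivity makes the product monotone, so [n y = 0]
    forces [n (y /\ n) = 0], hence [y /\ n = 0]; conversely [n y <= n /\ y].
    The same holds for [y n], so both annihilators are the join [p] of the
    elements disjoint from [n] ([l_ann_disjoint], [r_ann_disjoint]).
    Distributivity over that join gives [p n = 0], so [p] is itself disjoint
    from [n] and is the largest such element ([le_l_ann]).

    Primality of [p] follows by cutting down to [n]: if [x y <= p], then
    [(x /\ n) (y /\ n) <= p /\ n = 0], so [x] or [y] is disjoint from [n].
    Conversely a prime [q] disjoint from [n] lies below [p], and [p n = 0 <= q]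
    forces [p <= q], since [n <= q] would give [n = q /\ n = 0].

    The argument lives in any multiplicative lattice with infinite
    distributivity, hence in [[0, h]], which inherits the law from [L] ([lower_interval_distributive]). *)

Lemma bigjoin1 {d : Order.disp_t} {M : multLatticeType d} (x : M) :
  bigjoin [set x]%classic = x.
Proof.
have [ub lub] := bigjoin_supremum [set x]%classic.
by apply: le_anti; rewrite ub // lub // => _ ->.
Qed.

Lemma bigjoin_pair {d : Order.disp_t} {M : multLatticeType d} {x y : M} :
  x <= y -> bigjoin [set x; y]%classic = y.
Proof.
move=> xy; have [ub lub] := bigjoin_supremum [set x; y]%classic.
apply: le_anti; rewrite lub ?ub //; first by right.
by move=> _ [->|->].
Qed.

(** For [x <= x'] the factor [x'] is the join of [{x, x'}], and the product of
    joins lies above each product of members. *)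
Lemma lmul_mono {d : Order.disp_t} {M : multLatticeType d} :
  infinitely_m_distributive M ->
  forall x x' y y' : M, x <= x' -> y <= y' -> x ** y <= x' ** y'.
Proof.
move=> dM x x' y y' xx' yy'.
rewrite -(bigjoin_pair xx') -(bigjoin_pair yy') dM.
have [ub _] := bigjoin_supremum
  [set a ** b | a in [set x; x'] & b in [set y; y']]%classic.
by apply: ub; exists x; [left|exists y; [left|]].
Qed.

(** Joins and products in the interval are computed in [L], so the law
    restricts. *)
Lemma lower_interval_distributive {d : Order.disp_t} {L : multLatticeType d}
    (h : L) :
  infinitely_m_distributive L -> infinitely_m_distributive (lower_interval h).
Proof.
move=> dL X Y; apply: val_inj => /=; rewrite dL; congr bigjoin.
apply/seteqP; split=> [_ [_ [x Xx <-] [_ [y Yy <-] <-]]|].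
  by exists (x ** y) => //; exists x => //; exists y.
move=> _ [_ [x Xx [y Yy <-]] <-].
by exists (val x); [exists x|exists (val y) => //; exists y].
Qed.

(** Primality of [\bot] in the interval below [n], phrased with elements of the
    ambient lattice so that no nested interval is needed. *)
Definition domain_below {d : Order.disp_t} {M : multLatticeType d} (n : M) :=
  n <> \bot /\
  forall x y : M, x <= n -> y <= n -> x ** y = \bot -> x = \bot \/ y = \bot.

Lemma domain_below_lower_interval {d : Order.disp_t} {L : multLatticeType d}
    {h : L} {n : lower_interval h} :
  Spec (lower_interval (li_val n)) \bot -> domain_below n.
Proof.
move=> [n0 pr]; split=> [nE|x y xn yn xy0].
  by apply: n0; apply: val_inj; rewrite /= nE.
have := pr (LowerInterval (xn : li_val x <= li_val n))
           (LowerInterval (yn : li_val y <= li_val n)).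
rewrite !li_leE /= !lex0.
have -> : val x ** val y = \bot by exact: (congr1 val xy0).
by rewrite eqxx => /(_ isT) [] /eqP E; [left|right]; apply: val_inj.
Qed.

Section Annihilators.
Context {d : Order.disp_t} {M : multLatticeType d}.
Hypothesis dM : infinitely_m_distributive M.
Context {n : M}.
Hypothesis dn : domain_below n.

(** Cancelling [n] needs a second factor below [n]; monotonicity lets [y] be
    replaced by [y /\ n], and the absence of zero divisors below [n] does the
    rest. *)
Lemma lmul_eq0_disjoint (y : M) : (n ** y = \bot) <-> (y `&` n = \bot).
Proof.
split=> [ny0|yn0]; last first.
  by apply/eqP; rewrite -lex0 -yn0 meetC lmul_le_meet.
have [n0 dom] := dn; case: (dom n (y `&` n)) => //; first exact: leIr.
by apply/eqP; rewrite -lex0 -ny0 lmul_mono // leIl.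
Qed.

Lemma rmul_eq0_disjoint (y : M) : (y ** n = \bot) <-> (y `&` n = \bot).
Proof.
split=> [yn0|yn0]; last by apply/eqP; rewrite -lex0 -yn0 lmul_le_meet.
have [n0 dom] := dn; case: (dom (y `&` n) n) => //; first exact: leIr.
by apply/eqP; rewrite -lex0 -yn0 lmul_mono // leIl.
Qed.

Lemma r_ann_disjoint : r_ann n = bigjoin [set y | (y `&` n)%O = \bot]%classic.
Proof.
congr bigjoin; apply/seteqP.
by split=> y /=; rewrite lmul_eq0_disjoint.
Qed.

Lemma l_ann_disjoint : l_ann n = bigjoin [set y | (y `&` n)%O = \bot]%classic.
Proof.
congr bigjoin; apply/seteqP.
by split=> y /=; rewrite rmul_eq0_disjoint.
Qed.

(** Distributivity over arbitrary joins is what passes annihilation from the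
    members of the family to its join; [n] is written as a join of one
    element. *)
Lemma l_ann_mul : l_ann n ** n = \bot.
Proof.
rewrite -{2}(bigjoin1 n) dM; apply/eqP; rewrite -lex0.
have [_ lub] := bigjoin_supremum
  [set x ** y | x in [set y | y ** n = \bot] & y in [set n]]%classic.
by apply: lub => _ [x /= xn0 [_ -> <-]]; rewrite xn0.
Qed.

Lemma l_ann_meet : l_ann n `&` n = \bot.
Proof. by apply/rmul_eq0_disjoint; exact: l_ann_mul. Qed.

(** With [l_ann_meet], this makes [l_ann n] the pseudocomplement of [n]. *)
Lemma le_l_ann (x : M) : x `&` n = \bot -> x <= l_ann n.
Proof.
move=> xn0; rewrite l_ann_disjoint.
by have [ub _] := bigjoin_supremum [set y | (y `&` n)%O = \bot]%classic; apply: ub.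
Qed.

(** Meeting both factors with [n] moves the question to the interval below
    [n], where there are no zero divisors, and [le_l_ann] moves it back. *)
Lemma l_ann_prime : prime_elt (l_ann n).
Proof.
have [n0 dom] := dn; split=> [p1|x y xyp].
  by apply: n0; rewrite -l_ann_meet p1 meet1x.
have xy0 : (x `&` n) ** (y `&` n) = \bot.
  apply/eqP; rewrite -lex0 -l_ann_meet lexI; apply/andP; split.
    by apply: le_trans xyp; rewrite lmul_mono // leIl.
  by apply: le_trans (lmul_le_meet _ _) _; rewrite leIx2 // leIr.
by case: (dom _ _ (leIr _ _) (leIr _ _) xy0) => /le_l_ann; [left|right].
Qed.

(** Maximality of [l_ann n] gives [q <= l_ann n]; primality of [q] applied to
    [l_ann n ** n = \bot] gives the other inequality. *)
Lemma prime_disjoint_l_ann (q : M) :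
  prime_elt q -> q `&` n = \bot -> l_ann n = q.
Proof.
move=> [_ prq] qn0; apply: le_anti; rewrite le_l_ann // andbT.
case: (prq (l_ann n) n) => //; first by rewrite l_ann_mul le0x.
by move=> /meet_r nq; case: dn => n0; case: n0; rewrite -qn0.
Qed.

End Annihilators.

Theorem lemma4p13 (d : Order.disp_t) (L : multLatticeType d)
    (hL : infinitely_m_distributive L) (h : L) (n : lower_interval h)
    (hn : Spec (lower_interval (li_val n)) \bot) :
  l_ann n = r_ann n /\
  unique (fun p : lower_interval h =>
            Spec (lower_interval h) p /\ p `&` n = \bot) (l_ann n).
Proof.
have dM := lower_interval_distributive h hL.
have dn := domain_below_lower_interval hn.
split; first by rewrite (l_ann_disjoint dM dn) (r_ann_disjoint dM dn).
split; first by split; [exact: l_ann_prime|exact: l_ann_meet].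
by move=> q [prq qn0]; exact: prime_disjoint_l_ann.
Qed.
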